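(* Let $\Gamma$ be a finite tetravalent half-arc-transitive graph, with radius $r=\mathrm{rad}(\Gamma)$ and attachment number $a=\mathrm{att}(\Gamma)$. If $r$ is odd, then $a$ divides $r$. Consequently, if $a$ is not divisible by $4$, then $a$ divides $r$.
   Context: All graphs are finite and simple. For a tetravalent graph $\Gamma$ and $G\le \mathrm{Aut}(\Gamma)$, $\Gamma$ is $G$-half-arc-transitive if $G$ acts transitively on the vertices and on the edges but not on the arcs of $\Gamma$; $\Gamma$ is half-arc-transitive if it is $\mathrm{Aut}(\Gamma)$-half-arc-transitive. In that case the $G$-orbits on arcs give two paired orientations of the edges (choose one; write $u\to v$), and each vertex is the tail of two and the head of two of its incident edges. A $G$-alternating cycle is a cycle of $\Gamma$ in which every two consecutive edges have either a common head or a common tail. All $G$-alternating cycles have the same even length $2\,\mathrm{rad}_G(\Gamma)$ ($\mathrm{rad}_G(\Gamma)$ is the $G$-radius), and any two $G$-alternating cycles sharing a vertex meet in the same number $\mathrm{att}_G(\Gamma)$ of vertices (the $G$-attachment number). $\mathrm{rad}(\Gamma)$ and $\mathrm{att}(\Gamma)$ denote these parameters for $G=\mathrm{Aut}(\Gamma)$. *)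

(* Defs.v *)
From mathcomp Require Import all_boot all_fingroup.
Set Implicit Arguments.
Unset Strict Implicit.
Unset Printing Implicit Defensive.

Section Graphs.
Variable T : finType.
Implicit Types (e : rel T) (D : rel T) (s : seq T).

Definition simple_graph e := symmetric e /\ irreflexive e.

Definition tetravalent e := forall x : T, #|[set y | e x y]| = 4.

Definition is_aut e (g : {perm T}) : bool :=
  [forall x, forall y, e (g x) (g y) == e x y].

Definition vertex_transitive e :=
  forall x y : T, exists g, is_aut e g /\ g x = y.

Definition edge_transitive e :=
  forall x y u v : T, e x y -> e u v ->
    exists g, is_aut e g /\ ((g x = u /\ g y = v) \/ (g x = v /\ g y = u)).

Definition arc_transitive e :=
  forall x y u v : T, e x y -> e u v ->
    exists g, is_aut e g /\ g x = u /\ g y = v.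

Definition half_arc_transitive e :=
  [/\ vertex_transitive e, edge_transitive e & ~ arc_transitive e].

(* The orientation given by the Aut-orbit on arcs containing (x0,y0):
   u -> v iff some automorphism maps the arc (x0,y0) to (u,v). *)
Definition orient e (x0 y0 : T) : rel T :=
  fun u v => [exists g : {perm T}, [&& is_aut e g, g x0 == u & g y0 == v]].

Definition ehead D (p : T * T) : T := if D p.1 p.2 then p.2 else p.1.
Definition etail D (p : T * T) : T := if D p.1 p.2 then p.1 else p.2.

Definition epairs s : seq (T * T) := zip s (rot 1 s).

Definition alt_cycle D e s : bool :=
  [&& 2 < size s, uniq s, path.cycle e s &
      all (fun pq => (ehead D pq.1 == ehead D pq.2)
                     || (etail D pq.1 == etail D pq.2))
          (zip (epairs s) (rot 1 (epairs s)))].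

(* edge set of a cycle (used to tell distinct cycles apart) *)
Definition cyc_edges s : {set {set T}} :=
  [set [set p.1; p.2] | p in epairs s].

Definition cyc_verts s : {set T} := [set x in s].

End Graphs.

(* Main.v *)
Require Import Defs.
From mathcomp Require Import all_boot all_fingroup.

Set Implicit Arguments.
Unset Strict Implicit.
Unset Printing Implicit Defensive.

(** The vertex set of an alternating cycle [C] is partitioned into the blocks
    [C :&: C'], [C'] ranging over the other cycles meeting [C]; hence [a] divides
    [2r], and only the case [r] odd, [a] even needs work. Let [v] lie on [C] as a
    tail and on [C'] as a head. By edge-transitivity some automorphism fixes [v]
    and reflects [C]; on [C] it fixes only [v] and the antipode of [v]. It
    preserves [C :&: C'], which has even size, so the antipode of [v] on [C]
    lies on [C'], and symmetrically with [C] and [C'] exchanged. Comparing the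
    fixed points shows that the two antipodes of [v] coincide. The resulting
    antipode map of the whole graph is an automorphism which, [r] being odd,
    reverses the orientation, contradicting half-arc-transitivity. *)

(** * Sequences, periods of iterates, and involutions *)

Lemma rot1_mkseq (A : Type) (f : nat -> A) n :
  0 < n -> f n = f 0 -> rot 1 (mkseq f n) = mkseq (fun i => f i.+1) n.
Proof.
case: n => // n _ fn.
by rewrite [RHS]mkseqS fn /mkseq /= rot1_cons (iotaDl 1 0) -map_comp.
Qed.

Lemma zip_mkseq (A B : Type) (f : nat -> A) (g : nat -> B) n :
  zip (mkseq f n) (mkseq g n) = mkseq (fun i => (f i, g i)) n.
Proof. by rewrite /mkseq; elim: (iota 0 n) => //= i s ->. Qed.

Lemma iter_modn_order (A : finType) (f : A -> A) (x : A) n :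
  injective f -> iter (n %% fingraph.order f x) f x = iter n f x.
Proof.
move=> injf; rewrite {2}(divn_eq n (fingraph.order f x)) addnC iterD.
by congr (iter _ f _); elim: (n %/ _) => // k IHk; rewrite mulSn iterD -IHk iter_order.
Qed.

Lemma iter_eq_dvd (A : finType) (f : A -> A) (x : A) n :
  injective f -> iter n f x = x -> fingraph.order f x %| n.
Proof.
move=> injf; rewrite -(iter_modn_order _ _ injf) => fx.
have /findex_iter : n %% fingraph.order f x < fingraph.order f x.
  by rewrite ltn_mod fingraph.order_gt0.
by rewrite fx findex0 /dvdn => <-.
Qed.

(** The points of [S] other than [x0] split into pairs [x], [f x], removed one pair at a time.
    Involutivity is asked only on [S] because the reflections used later square to the identity only
    on a cycle. *)
Lemma odd_card_involution (A : finType) (f : A -> A) (x0 : A) (S : {set A}) :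
  x0 \in S -> (forall x, x \in S -> f x \in S) ->
  (forall x, x \in S -> f (f x) = x) ->
  (forall x, x \in S -> (f x == x) = (x == x0)) -> odd #|S|.
Proof.
have [n] := ubnP #|S|; elim: n S => // n IHn S /ltnSE leSn Sx0 fS ffS fixS.
case: (pickP [pred x in S | x != x0]) => [x /= /andP[Sx nx0] | S0]; last first.
  rewrite (_ : S = [set x0]) ?cards1 //; apply/setP=> y; rewrite !inE.
  by have /= := S0 y; case: eqP => [->|_]; rewrite ?Sx0 // andbT.
have fx_x : f x != x by rewrite fixS.
have fx_x0 : f x != x0 by rewrite -fixS ?fS // ffS // eq_sym.
have cS : #|S| = #|S :\ x :\ f x|.+2.
  by rewrite (cardsD1 x) Sx (cardsD1 (f x)) !inE fx_x fS.
rewrite cS /= negbK; apply: IHn.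
- by apply: leq_trans leSn; rewrite cS.
- by rewrite !inE Sx0 !(eq_sym x0) fx_x0 nx0.
- move=> y; rewrite !inE => /and3P[yfx yx Sy]; rewrite fS // andbT; apply/andP; split.
    by apply: contra yx => /eqP/(congr1 f); rewrite !ffS // => ->.
  by apply: contra yfx => /eqP <-; rewrite ffS.
- by move=> y; rewrite !inE => /and3P[_ _]; apply: ffS.
- by move=> y; rewrite !inE => /and3P[_ _]; apply: fixS.
Qed.

(** * Darts and the alternating walks they generate *)

Section AlternatingCycles.

Variables (T : finType) (D : rel T).

(* A dart [(v, u)] has type [b] when [role b v u]: [v] is the tail of the edge
   if [b = true] and its head if [b = false]. *)
Definition role (b : bool) (v u : T) := if b then D v u else D u v.

(** The default [v] makes [sibling ^~ u] an involution on all of [T], so that [advance] is injective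
    on all pairs and not only on darts. *)
Definition sibling (v u : T) : T :=
  odflt v [pick w | (w != v) && [exists b, role b v u && role b w u]].

Definition advance (d : T * T) : T * T := (d.2, sibling d.1 d.2).

(** The same alternating cycle, left from [d.1] in the other direction. *)
Definition mirror (d : T * T) : T * T := (d.1, sibling d.2 d.1).

Hypothesis D_asym : forall u v, D u v -> ~~ D v u.
Hypothesis D_deg : forall b v, #|[set u | role b v u]| = 2.
Hypothesis D_trans : forall u v u' v', D u v -> D u' v' ->
  exists g : {perm T},
    [/\ forall x y, D (g x) (g y) = D x y, g u = u' & g v = v'].

Lemma roleN b v u : role (~~ b) v u = role b u v.
Proof. by case: b. Qed.

Lemma role_inj b b' v u : role b v u -> role b' v u -> b = b'.
Proof. by case: b b' => [] [] //= H /D_asym; rewrite H. Qed.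

Lemma role_neq b v u : role b v u -> v != u.
Proof.
by move=> H; apply/eqP=> E; subst u; case: b H => /= H; have := D_asym H; rewrite H.
Qed.

Lemma role_sibling b v u :
  role b v u -> role b (sibling v u) u /\ sibling v u != v.
Proof.
move=> bvu; rewrite /sibling; case: pickP => [w /andP[wv /existsP[b' /andP[]]] | no_w] /=.
  by move=> /(role_inj bvu) <-.
have /cards2P[x [y [xy E]]] := introT eqP (D_deg (~~ b) u).
have := no_w (if v == x then y else x).
have inE' w : role b w u = (w \in [set x; y]) by rewrite -E inE roleN.
move=> /negP[]; apply/andP; split; first by case: (eqVneq v x) => [->|]; rewrite eq_sym.
apply/existsP; exists b; rewrite bvu inE' !inE /=.
by case: (v == x); rewrite eqxx ?orbT.
Qed.

Lemma sibling_unique b v w u : role b v u -> role b w u -> w != v -> w = sibling v u.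
Proof.
move=> bvu bwu wv; have [bsu sv] := role_sibling bvu.
apply/eqP/negPn/negP=> ws.
have : [set v; w; sibling v u] \subset [set u' | role (~~ b) u u'].
  by apply/subsetP=> z; rewrite !inE roleN => /orP[/orP[]|] /eqP->.
move/subset_leq_card; rewrite D_deg setUC cardsU1 cards2 !inE.
by rewrite negb_or sv eq_sym ws eq_sym wv.
Qed.

Lemma sibling_id v u : ~~ [exists b, role b v u] -> sibling v u = v.
Proof.
move=> nvu; rewrite /sibling; case: pickP => [w /andP[_ /existsP[b /andP[bvu _]]] | //].
by case/existsP: nvu; exists b.
Qed.

Lemma siblingK v u : sibling (sibling v u) u = v.
Proof.
case: (boolP [exists b, role b v u]) => [/existsP[b bvu] | nvu].
  by have [bsu sv] := role_sibling bvu; rewrite -(sibling_unique bsu bvu) // eq_sym.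
by rewrite !sibling_id.
Qed.

Lemma mirrorK : involutive mirror.
Proof. by case=> v u; rewrite /mirror /= siblingK. Qed.

(** The dihedral relation: together with [mirrorK], [mirror] conjugates [advance] to its inverse. *)
Lemma advance_mirror d : advance (mirror (advance d)) = mirror d.
Proof. by case: d => v u; rewrite /mirror /advance /= siblingK. Qed.

Lemma advance_inj : injective advance.
Proof.
by apply: (can_inj (g := mirror \o advance \o mirror)) => d /=; rewrite advance_mirror mirrorK.
Qed.

Lemma iter_advance_inj k : injective (iter k advance).
Proof. by elim: k => [|k IHk] x y //= /advance_inj/IHk. Qed.

Lemma iter_advance_mirror k d : iter k advance (mirror (iter k advance d)) = mirror d.
Proof. by elim: k => [|k IHk] //; rewrite iterSr /= advance_mirror. Qed.

Definition drole b (d : T * T) := role b d.1 d.2.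

Lemma drole_advance b d : drole b d -> drole (~~ b) (advance d).
Proof. by move=> /role_sibling[]; rewrite /drole roleN. Qed.

Lemma drole_iter b k d : drole b d -> drole (b (+) odd k) (iter k advance d).
Proof.
move=> bd; elim: k => [|k IHk] /=; first by rewrite addbF.
by rewrite addbN; apply: drole_advance.
Qed.

Lemma drole_inj b b' d : drole b d -> drole b' d -> b = b'.
Proof. exact: role_inj. Qed.

Lemma drole_mirror b d : drole b d -> drole b (mirror d).
Proof. by rewrite /drole -roleN => /role_sibling[]; rewrite roleN. Qed.

Lemma mirror_neq b d : drole b d -> mirror d != d.
Proof.
case: d => v u; rewrite /drole -roleN => /role_sibling[_ /= su].
by apply/eqP=> -[E]; rewrite E eqxx in su.
Qed.

Lemma same_role_darts b d d' :
  drole b d -> drole b d' -> d.1 = d'.1 -> d' = d \/ d' = mirror d.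
Proof.
case: d d' => v u [v' u'] bd bd' /= E; subst v'.
case: (eqVneq u' u) => [-> | u'u]; [by left | right].
by congr (_, _); apply: (@sibling_unique (~~ b)); rewrite ?roleN.
Qed.

Lemma iter_mirrorC k d :
  iter k advance (mirror d) = mirror (iter k advance d) <->
  iter k.*2 advance (mirror d) = mirror d.
Proof.
rewrite -addnn iterD; split=> [-> | ]; first exact: iter_advance_mirror.
by rewrite -{2}(iter_advance_mirror k d) => /iter_advance_inj.
Qed.

Lemma iter_mirror_fix k d : iter k advance (mirror d) = mirror d <-> iter k advance d = d.
Proof.
have H d' : iter k advance d' = d' -> iter k advance (mirror d') = mirror d'.
  by move=> E; rewrite -{2}(iter_advance_mirror k d') E.
by split=> /H; rewrite ?mirrorK.
Qed.

(** Roles alternate along the walk and [mirror] keeps them, so [k] would be even; by the dihedral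
    relation the dart halfway would then equal its own mirror image. *)
Lemma iter_neq_mirror b k d : drole b d -> iter k advance d <> mirror d.
Proof.
move=> bd E; have := drole_iter k bd; rewrite E => /(drole_inj (drole_mirror bd)).
case ok: (odd k); first by case: (b).
move=> _; have := odd_double_half k; rewrite ok add0n => Ek.
move: E; rewrite -Ek -addnn iterD -(iter_advance_mirror k./2 d) => /iter_advance_inj /esym E.
by have := mirror_neq (drole_iter k./2 bd); rewrite E eqxx.
Qed.

(** * Action of orientation-preserving permutations on darts *)

Section Automorphism.

Variable g : {perm T}.
Hypothesis Dg : forall x y, D (g x) (g y) = D x y.

Definition dmap (d : T * T) := (g d.1, g d.2).

Lemma role_perm b x y : role b (g x) (g y) = role b x y.
Proof. by case: b => /=. Qed.

Lemma sibling_perm v u : sibling (g v) (g u) = g (sibling v u).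
Proof.
case: (boolP [exists b, role b v u]) => [/existsP[b bvu] | nvu].
  have [bsu sv] := role_sibling bvu; apply/esym/(@sibling_unique b); rewrite ?role_perm //.
  by rewrite (inj_eq perm_inj).
rewrite !sibling_id //; apply: contra nvu => /existsP[b]; rewrite role_perm => bvu.
by apply/existsP; exists b.
Qed.

Lemma iter_dmap k d : iter k advance (dmap d) = dmap (iter k advance d).
Proof. by elim: k => //= k ->; rewrite /advance /dmap /= sibling_perm. Qed.

Lemma mirror_dmap d : mirror (dmap d) = dmap (mirror d).
Proof. by rewrite /mirror /dmap /= sibling_perm. Qed.

Lemma drole_dmap b d : drole b (dmap d) = drole b d.
Proof. exact: role_perm. Qed.

End Automorphism.

(** Applied to [d] and [mirror d], this supplies the reflection of the cycle at [d.1]. *)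
Lemma drole_trans b d d' : drole b d -> drole b d' ->
  exists2 g : {perm T}, forall x y, D (g x) (g y) = D x y & dmap g d = d'.
Proof.
case: b d d' => [] [v u] [v' u'] H H'; have [g [Dg E1 E2]] := D_trans H H';
  by exists g; rewrite // /dmap /= E1 E2.
Qed.

(* If a walk returned to [v] in the opposite role, the automorphism reflecting
   it at [v] would make its period [2k] with [k] odd, and translating by
   [k + 1] would turn the first edge around. *)
Lemma iter_opposite_role b k d :
  drole b d -> odd k -> (iter k advance d).1 <> d.1.
Proof.
move=> bd ok E.
have [g Dg gd] := drole_trans bd (drole_mirror bd).
have brd := drole_mirror bd.
have gv : g d.1 = d.1 by have := congr1 fst gd.
have E' : (iter k advance (mirror d)).1 = d.1.
  by rewrite -gd iter_dmap //= E.
have per : iter k.*2 advance (mirror d) = mirror d.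
  apply/iter_mirrorC.
  have b1 := drole_iter k brd; have b2 := drole_iter k bd.
  have [|//] := same_role_darts b2 b1 (etrans E (esym E')).
  by move/iter_advance_inj/eqP; rewrite (negPf (mirror_neq bd)).
have {}per : iter k.*2 advance d = d by apply/iter_mirror_fix.
have bk1 : drole b (iter k.+1 advance d).
  by have := drole_iter k.+1 bd; rewrite /= ok addbF.
have [h Dh hd] := drole_trans bd bk1.
have : (iter k advance (dmap h d)).1 = (dmap h d).1 by rewrite iter_dmap //= E.
(* Since [advance] has returned to [d] after [2k] steps, [E2] says that dart number [k] ends at
   [d.2]. It also starts at [d.1], so it is [d] with the opposite role. *)
rewrite hd -iterD addnS addnn iterS per /= => E2.
have := drole_iter k bd; rewrite ok.
rewrite /drole E -E2 addbT => /role_inj /(_ bd).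
by case: (b).
Qed.

(** A vertex cannot recur in the opposite role, and in the same role it recurs with the same dart or
    its mirror image; the latter is excluded by [iter_neq_mirror]. *)
Lemma walk_inj b d i j : drole b d ->
  (iter i advance d).1 = (iter j advance d).1 -> iter i advance d = iter j advance d.
Proof.
move=> bd; wlog le_ij : i j / i <= j.
  by move=> H; case/orP: (leq_total i j) => /H // {}H /esym/H.
rewrite -(subnK le_ij) iterD; move: (j - i) => k.
have := drole_iter i bd; move: (b (+) odd i) (iter i advance d) => c d' cd' /esym E.
case ok: (odd k); first by case: (iter_opposite_role cd' ok).
have := drole_iter k cd'; rewrite ok addbF => ckd'.
have [//|E'] := same_role_darts cd' ckd' (esym E).
by case: (iter_neq_mirror cd' E').
Qed.

Lemma exists_dart b v : exists d, drole b d /\ d.1 = v.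
Proof.
have : 0 < #|[set u | role b v u]| by rewrite D_deg.
by case/card_gt0P=> u; rewrite inE => bvu; exists (v, u).
Qed.

(** * Walks over one period as alternating cycles *)

Notation period := (fingraph.order advance).

Lemma iter_period d : iter (period d) advance d = d.
Proof. exact: (iter_order advance_inj). Qed.

Lemma period_even b d : drole b d -> odd (period d) = false.
Proof.
move=> bd; have := drole_iter (period d) bd; rewrite iter_period => /(drole_inj bd).
by case: (odd _) => //; case: (b).
Qed.

Lemma period_gt2 b d : drole b d -> 2 < period d.
Proof.
move=> bd; have := iter_period d; have := fingraph.order_gt0 advance d.
have := period_even bd; case: (period d) => [|[|[|]]] //= _ _ E.
have [_] := role_sibling bd.
by rewrite [sibling _ _](congr1 fst E) eqxx.
Qed.

Definition walk d := mkseq (fun i => (iter i advance d).1) (period d).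

Lemma epairs_walk d : epairs (walk d) = mkseq (fun i => iter i advance d) (period d).
Proof.
rewrite /epairs /walk rot1_mkseq ?fingraph.order_gt0 ?iter_period //.
by rewrite zip_mkseq; apply: eq_mkseq => i; rewrite [RHS]surjective_pairing.
Qed.

Lemma mem_walk d i : (iter i advance d).1 \in walk d.
Proof.
rewrite -(iter_modn_order _ _ advance_inj); apply: map_f.
by rewrite mem_iota ltn_mod fingraph.order_gt0.
Qed.

Lemma walkP x d : x \in walk d -> exists i, x = (iter i advance d).1.
Proof. by case/mapP=> i _ ->; exists i. Qed.

Lemma walkE d : walk d = map fst (fingraph.orbit advance d).
Proof.
apply: (@eq_from_nth _ d.1) => [|i].
  by rewrite size_mkseq size_map size_traject.
rewrite size_mkseq => lti.
by rewrite nth_mkseq // (nth_map d) ?size_traject // nth_traject.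
Qed.

Lemma drole_ehead b d : drole b d -> ehead D d = if b then d.2 else d.1.
Proof. by case: d b => v u [] /= H; rewrite /ehead /= ?H // (negPf (D_asym H)). Qed.

Lemma drole_etail b d : drole b d -> etail D d = if b then d.1 else d.2.
Proof. by case: d b => v u [] /= H; rewrite /etail /= ?H // (negPf (D_asym H)). Qed.

Variable e : rel T.
Hypothesis eD : forall u v, e u v = D u v || D v u.

Lemma role_edge b v u : role b v u -> e v u.
Proof. by rewrite eD; case: b => /= ->; rewrite ?orbT. Qed.

Lemma alt_cycle_walk b d : drole b d -> alt_cycle D e (walk d).
Proof.
move=> bd; apply/and4P; split.
- by rewrite size_mkseq (period_gt2 bd).
- apply/mkseq_uniqP=> i j lti ltj /(walk_inj bd) E.
  by rewrite -(findex_iter lti) E (findex_iter ltj).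
- rewrite walkE cycle_map.
  have orbit_dart : all (fun y => e y.1 y.2) (fingraph.orbit advance d).
    by apply/allP=> _ /trajectP[i _ ->]; apply: role_edge (drole_iter i bd).
  apply: sub_in_cycle orbit_dart (cycle_orbit advance_inj d).
  by move=> y z ey _ /eqP <-.
- rewrite epairs_walk rot1_mkseq ?fingraph.order_gt0 ?iter_period // zip_mkseq.
  apply/allP=> _ /mapP[i _ ->] /=.
  have bi := drole_iter i bd; have := drole_advance bi.
  move: (b (+) odd i) (iter i advance d) bi => c y cy cay.
  rewrite (drole_ehead cy) (drole_ehead cay) (drole_etail cy) (drole_etail cay).
  by case: c {cy cay}; rewrite /= eqxx ?orbT.
Qed.

(** The attachment number tells cycles apart by their edge sets. Along [walk d'] the vertex [d.1] is
    always a head, so the edge of [d], whose tail it is, does not occur there. *)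
Lemma cyc_edges_walk d d' : drole true d -> drole false d' -> d.1 = d'.1 ->
  cyc_edges (walk d) != cyc_edges (walk d').
Proof.
move=> bd bd' Ed; apply/eqP=> E.
have : [set d.1; d.2] \in cyc_edges (walk d).
  apply/imsetP; exists d => //; rewrite epairs_walk.
  by apply/mapP; exists 0; rewrite // mem_iota fingraph.order_gt0.
rewrite E => /imsetP[y]; rewrite epairs_walk => /mapP[i _ ->] {y} Ey.
have : d.1 \in [set d.1; d.2] by rewrite !inE eqxx.
have : d.2 \in [set d.1; d.2] by rewrite !inE eqxx orbT.
have d12 := role_neq bd.
have bi := drole_iter i bd'.
rewrite Ey !inE => d2 /orP[] /eqP d1.
  have Ei : iter i advance d' = d' by apply: (walk_inj (j := 0) bd'); rewrite -d1.
  move: d2; rewrite -d1 eq_sym (negPf d12) Ei /= => /eqP E2.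
  by have := D_asym bd; rewrite Ed E2 => /negP[].
have Ei : iter i.+1 advance d' = d' by apply: (walk_inj (j := 0) bd'); rewrite -Ed.
move: d2; rewrite -d1 [d.2 == d.1]eq_sym (negPf d12) orbF => /eqP d2.
have := drole_iter i.+1 bd'; rewrite Ei => /(drole_inj bd') /=.
case: (odd i) bi => //=; rewrite /drole -d1 -d2 => bi _.
by have := D_asym bd; rewrite bi.
Qed.

(* The graph on pairs (vertex, role), whose components are the alternating cycles. *)
Definition role_adj : rel (T * bool) := fun p q => role p.2 p.1 q.1 && (q.2 == ~~ p.2).

Lemma role_adj_sym : connect_sym role_adj.
Proof.
apply: sym_connect_sym => -[x b] [y c]; rewrite /role_adj /=.
by case: b c => [] [] /=; rewrite ?andbF ?andbT.
Qed.

(** The root names the component, so cycles are compared by equality; [cyc true x] and [cyc false x]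
    are the two cycles through [x]. *)
Definition cyc b x := root role_adj (x, b).

Definition verts (C : T * bool) := [set x | (cyc true x == C) || (cyc false x == C)].

Lemma iter_mirror k b d : drole b d ->
  exists2 j, iter k advance (mirror d) = mirror (iter j advance d) & odd j = odd k.
Proof.
move=> bd; have le_k : k <= period d * k by rewrite leq_pmull ?fingraph.order_gt0.
(* Walking [k] steps backwards is walking this many steps forwards; the period is even, so parity is
   kept. *)
exists (period d * k - k); last by rewrite oddB // oddM (period_even bd).
rewrite -(iter_advance_mirror k (iter (period d * k - k) advance d)) -iterD subnKC //.
by rewrite -[iter (_ * _) _ _](iter_modn_order _ _ advance_inj) modnMr.
Qed.

(** A path in [role_adj] may turn back at any vertex. It then follows the mirror walk, which
    [iter_mirror] turns into a forward walk from [d]. *)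
Lemma connect_roleP b d p : drole b d ->
  reflect (exists i, p = ((iter i advance d).1, b (+) odd i)) (connect role_adj (d.1, b) p).
Proof.
move=> bd; apply: (iffP idP) => [/connectP[s] | [i ->] {p}].
  elim: s b d bd => [|[y c] s IHs] b d bd /=; first by exists 0; rewrite addbF.
  case/andP=> /andP[/= by_ /eqP ->] ps pE.
  have bd2 : drole b (d.1, y) by [].
  have [E|E] := same_role_darts bd bd2 erefl; have Ey := congr1 snd E; rewrite /= in Ey.
    subst y.
    have [i ->] := IHs _ _ (drole_advance bd) ps pE.
    by exists i.+1; rewrite iterSr /= addNb addbN.
  subst y; have [i ->] := IHs _ _ (drole_advance (drole_mirror bd)) ps pE.
  have [j Ej oj] := iter_mirror i.+1 bd.
  by exists j; rewrite -iterSr Ej oj /= addNb addbN.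
elim: i => [|i IHi]; first by rewrite addbF connect0.
apply: connect_trans IHi (connect1 _).
by rewrite /role_adj /= addbN eqxx andbT; apply: drole_iter.
Qed.

Lemma cyc_neq x : cyc true x != cyc false x.
Proof.
have [d [bd <-]] := exists_dart true x.
rewrite root_connect; last exact: role_adj_sym.
apply/negP=> /(connect_roleP _ bd)[i [E oi]].
by apply: (@iter_opposite_role _ i _ bd); rewrite // -[odd i]negbK -addTb -oi.
Qed.

Lemma cyc_verts_walk b d : drole b d -> cyc_verts (walk d) = verts (cyc b d.1).
Proof.
move=> bd; apply/setP=> x; rewrite !inE ![_ == cyc b _]eq_sym.
rewrite !root_connect; try exact: role_adj_sym.
apply/idP/orP => [/walkP[i ->] | H].
  have : connect role_adj (d.1, b) ((iter i advance d).1, b (+) odd i).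
    by apply/connect_roleP=> //; exists i.
  by case: (b (+) _); [left | right].
suff [c /(connect_roleP _ bd)[i [-> _]]] : exists c, connect role_adj (d.1, b) (x, c).
  exact: mem_walk.
by case: H; [exists true | exists false].
Qed.

(** * Counting with the radius and the attachment number *)

Variables r a : nat.
Hypothesis rad : forall s, alt_cycle D e s -> size s = 2 * r.
Hypothesis att : forall s1 s2, alt_cycle D e s1 -> alt_cycle D e s2 ->
  cyc_edges s1 != cyc_edges s2 -> cyc_verts s1 :&: cyc_verts s2 != set0 ->
  #|cyc_verts s1 :&: cyc_verts s2| = a.

Lemma period_rad b d : drole b d -> period d = 2 * r.
Proof. by move=> /alt_cycle_walk/rad; rewrite size_mkseq. Qed.

Lemma rad_gt0 (x : T) : 0 < r.
Proof.
have [d [bd _]] := exists_dart true x.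
by have := period_gt2 bd; rewrite (period_rad bd); case: (r).
Qed.

Lemma card_verts b x : #|verts (cyc b x)| = 2 * r.
Proof.
have [d [bd <-]] := exists_dart b x; rewrite -(cyc_verts_walk bd).
have /and4P[_ uw _ _] := alt_cycle_walk bd.
by rewrite cardsE (card_uniqP uw) size_mkseq (period_rad bd).
Qed.

Lemma mem_verts b x : x \in verts (cyc b x).
Proof. by rewrite inE; case: b; rewrite eqxx ?orbT. Qed.

Lemma card_att x : #|verts (cyc true x) :&: verts (cyc false x)| = a.
Proof.
have [d [bd dx]] := exists_dart true x; have [d' [bd' dx']] := exists_dart false x.
have Ed : d.1 = d'.1 by rewrite dx.
rewrite -{1}dx -dx' -(cyc_verts_walk bd) -(cyc_verts_walk bd').
apply: att (alt_cycle_walk bd) (alt_cycle_walk bd') (cyc_edges_walk bd bd' Ed) _.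
apply/set0Pn; exists x.
by rewrite (cyc_verts_walk bd) (cyc_verts_walk bd') dx dx' inE !mem_verts.
Qed.

(* The cycles meeting a given one partition its vertex set into blocks of size [a]. *)
Lemma att_dvd (x0 : T) : a %| 2 * r.
Proof.
rewrite -(card_verts true x0); set C := cyc true x0.
(* For [x] on [C], [f x] is the cycle through [x] other than [C]; its fibres are the blocks. *)
pose f x := if cyc true x == C then cyc false x else cyc true x.
have P := preim_partitionP f (verts C).
rewrite (@card_uniform_partition _ a _ _ _ P) ?dvdn_mull // => B /imsetP[x Cx ->].
have fN y : f y != C.
  rewrite /f; case: (eqVneq (cyc true y) C) => // <-.
  by rewrite eq_sym cyc_neq.
suff -> : [set y in verts C | f x == f y] = verts (cyc true x) :&: verts (cyc false x).
  exact: card_att.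
suff Ef : [set y in verts C | f x == f y] = verts C :&: verts (f x).
  rewrite Ef /f; move: Cx; rewrite inE.
  case: (eqVneq (cyc true x) C) => [-> // | _ /= /eqP ->].
  by rewrite setIC.
apply/setP=> y; rewrite in_setI [in LHS]inE; apply: andb_id2l.
move: (fN x); rewrite !inE /f -/(f x); move: (f x) => C' C'C.
case: (eqVneq (cyc true y) C) => [-> _ | _ /= /eqP ->].
  by rewrite eq_sym [C == C']eq_sym (negPf C'C).
by rewrite eq_sym [C == C']eq_sym (negPf C'C) orbF.
Qed.

(** * Antipodes on alternating cycles *)

Lemma iter_rad b d : drole b d -> iter r.*2 advance d = d.
Proof. by move=> bd; rewrite -mul2n -(period_rad bd) iter_period. Qed.

Lemma antipode_neq b d : drole b d -> (iter r advance d).1 != d.1.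
Proof.
move=> bd; apply/eqP=> /(walk_inj (j := 0) bd) /(iter_eq_dvd advance_inj).
have r0 := rad_gt0 d.1; rewrite (period_rad bd) => /(dvdn_leq r0).
by rewrite leqNgt -{1}[r]mul1n ltn_pmul2r.
Qed.

Lemma antipode_mirror b d :
  drole b d -> (iter r advance (mirror d)).1 = (iter r advance d).1.
Proof.
move=> bd; have /iter_mirrorC -> // : iter r.*2 advance (mirror d) = mirror d.
exact: iter_rad (drole_mirror bd).
Qed.

(** The hypothesis says that the reflection at [d.1] fixes the [i]-th vertex. Then the period [2r]
    divides [2i], and the parity of [i / r] decides between [d.1] and its antipode. *)
Lemma mirror_fixed b d i : drole b d ->
  (iter i advance (mirror d)).1 = (iter i advance d).1 ->
  (iter i advance d).1 = d.1 \/ (iter i advance d).1 = (iter r advance d).1.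
Proof.
move=> bd E; have bi := drole_iter i bd; have bmi := drole_iter i (drole_mirror bd).
have [/iter_advance_inj/eqP | ] := same_role_darts bi bmi (esym E).
  by rewrite (negPf (mirror_neq bd)).
move=> /iter_mirrorC/iter_mirror_fix/(iter_eq_dvd advance_inj).
rewrite (period_rad bd) -mul2n dvdn_pmul2l // => /dvdnP[q ->] {i E bi bmi}.
rewrite -(odd_double_half q) mulnDl -muln2 -mulnA -(period_rad bd).
rewrite -(iter_modn_order _ _ advance_inj) addnC modnMDl (iter_modn_order _ _ advance_inj).
by case: (odd q); rewrite ?mul1n; [right | left].
Qed.

Lemma cyc_verts_same b d d' :
  drole b d -> drole b d' -> d.1 = d'.1 -> cyc_verts (walk d) = cyc_verts (walk d').
Proof. by move=> bd bd' E; rewrite (cyc_verts_walk bd) (cyc_verts_walk bd') E. Qed.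

Lemma card_att_darts b d d' : drole b d -> drole (~~ b) d' -> d.1 = d'.1 ->
  #|cyc_verts (walk d) :&: cyc_verts (walk d')| = a.
Proof.
move=> bd bd' E; rewrite (cyc_verts_walk bd) (cyc_verts_walk bd') E.
by case: (b); rewrite ?[verts (cyc false _) :&: _]setIC card_att.
Qed.

Lemma walk_dmap (g : {perm T}) d x : (forall y z, D (g y) (g z) = D y z) ->
  x \in walk d -> g x \in walk (dmap g d).
Proof.
move=> Dg /walkP[i ->]; suff -> : g (iter i advance d).1 = (iter i advance (dmap g d)).1.
  exact: mem_walk.
by rewrite iter_dmap.
Qed.

(* The reflection at [d.1] is an involution on the intersection of the two
   cycles, whose fixed points are [d.1] and possibly its antipode. *)
Lemma antipode_mem b d d' : ~~ odd a -> drole b d -> drole (~~ b) d' -> d.1 = d'.1 ->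
  (iter r advance d).1 \in walk d'.
Proof.
move=> ea bd bd' Ed; apply: contraR ea => nr.
have [g Dg gd] := drole_trans bd (drole_mirror bd).
have gd1 : g d.1 = d.1 by have := congr1 fst gd.
have gi i : g (iter i advance d).1 = (iter i advance (mirror d)).1.
  by rewrite -gd iter_dmap.
have gmi i : g (iter i advance (mirror d)).1 = (iter i advance d).1.
  by rewrite -{2}(mirrorK d) -{2}gd mirror_dmap // iter_dmap.
rewrite -(card_att_darts bd bd' Ed).
apply: (@odd_card_involution _ g d.1).
- by rewrite !inE (mem_walk d 0) Ed (mem_walk d' 0).
- move=> x; rewrite in_setI => /andP[xd xd'].
  rewrite in_setI; apply/andP; split.
    rewrite (cyc_verts_same bd (drole_mirror bd)) // -gd inE.
    by apply: walk_dmap; rewrite // inE in xd.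
  (* As [g] fixes [d'.1] and preserves roles, it maps the second cycle to itself. *)
  rewrite (@cyc_verts_same (~~ b) d' (dmap g d')) ?drole_dmap //; last by rewrite /= -Ed.
  by rewrite inE; apply: walk_dmap; rewrite // inE in xd'.
- by move=> x; rewrite !inE => /andP[/walkP[i ->] _]; rewrite gi gmi.
- move=> x; rewrite !inE => /andP[/walkP[i xi] xd'].
  apply/eqP/eqP=> [|->//]; rewrite xi gi => /(mirror_fixed bd)[// | E].
  by rewrite -E -xi xd' in nr.
Qed.

(** The reflection [g] of the first cycle at [d.1] either fixes the second cycle pointwise or
    reflects it. In the first case the antipode on the second cycle, which lies on the first, is
    fixed by the reflection there; in the other case the roles of the cycles are exchanged. Either
    way [mirror_fixed] identifies the antipodes. *)
Lemma antipode_role b d d' : ~~ odd a -> drole b d -> drole (~~ b) d' -> d.1 = d'.1 ->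
  (iter r advance d).1 = (iter r advance d').1.
Proof.
move=> ea bd bd' Ed.
have /walkP[k Ek] := antipode_mem ea bd bd' Ed.
have /walkP[l El] : (iter r advance d').1 \in walk d.
  by apply: (@antipode_mem (~~ b)); rewrite ?negbK.
have [g Dg gd] := drole_trans bd (drole_mirror bd).
have gd1 : g d.1 = d.1 by have := congr1 fst gd.
have bgd' : drole (~~ b) (dmap g d') by rewrite drole_dmap.
have gd1' : d'.1 = (dmap g d').1 by rewrite /= -Ed.
have [gd'|gd'] := same_role_darts bd' bgd' gd1'.
  have : g (iter r advance d').1 = (iter r advance d').1.
    by rewrite -{2}gd' iter_dmap.
  rewrite El -[g _]/((dmap g _).1) -iter_dmap // gd => /(mirror_fixed bd)[|//].
  by rewrite -El Ed => /eqP; rewrite (negPf (antipode_neq bd')).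
have : g (iter r advance d).1 = (iter r advance d).1.
  by rewrite -[RHS](antipode_mirror bd) -gd iter_dmap.
rewrite Ek -[g _]/((dmap g _).1) -iter_dmap // gd' => /(mirror_fixed bd')[|//].
by rewrite -Ek -Ed => /eqP; rewrite (negPf (antipode_neq bd)).
Qed.

(** Measured on the cycle where [v] is a tail; by [antipode_mirror] the choice of out-neighbour does
    not matter. *)
Definition antipode v := (iter r advance (v, odflt v [pick u | D v u])).1.

Lemma antipodeE b d : ~~ odd a -> drole b d -> antipode d.1 = (iter r advance d).1.
Proof.
move=> ea bd; rewrite /antipode; case: pickP => [u Du | no_u] /=; last first.
  by have [[v u] [H /= E]] := exists_dart true d.1; have := no_u u; rewrite -E [D _ _]H.
have bdu : drole true (d.1, u) by [].
case: b bd => bd; last by apply: (antipode_role ea bdu).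
by case: (same_role_darts bdu bd erefl) => ->; rewrite ?(antipode_mirror bdu).
Qed.

Lemma antipode_reverses : odd r -> ~~ odd a ->
  exists f : {perm T}, forall x y, D (f y) (f x) = D x y.
Proof.
move=> or ea; have antiK : involutive antipode.
  move=> x; have [d [bd <-]] := exists_dart true x.
  rewrite (antipodeE ea bd) (antipodeE ea (drole_iter r bd)) -iterD addnn.
  by rewrite (iter_rad bd).
have rev x y : D x y -> D (antipode y) (antipode x).
  move=> Dxy; have bd : drole true (x, y) by [].
  (* Both antipodes are read on the cycle through the edge from [x] to [y], where they are the ends
     of dart number [r]; for odd [r] its role is flipped. *)
  rewrite (antipodeE ea bd) (antipodeE ea (drole_advance bd)) -iterSr.
  by have := drole_iter r bd; rewrite or.
exists (perm (inv_inj antiK)) => x y; rewrite !permE; apply/idP/idP=> /rev //.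
by rewrite !antiK.
Qed.

Lemma att_dvd_rad (x0 : T) :
  (forall f : {perm T}, ~ forall x y, D (f y) (f x) = D x y) -> odd r -> a %| r.
Proof.
move=> no_rev or; case: (boolP (odd a)) => [oa | ea].
  by have := att_dvd x0; rewrite Gauss_dvdr // coprimen2.
by have [f /no_rev] := antipode_reverses or ea.
Qed.

End AlternatingCycles.

(** * The orientation of a half-arc-transitive graph *)

Section Orientation.

Variables (T : finType) (e : rel T) (x0 y0 : T).
Hypothesis e_simple : simple_graph e.
Hypothesis e_tetra : tetravalent e.
Hypothesis e_hat : half_arc_transitive e.
Hypothesis e00 : e x0 y0.

Notation D := (orient e x0 y0).

Lemma is_autP (g : {perm T}) :
  reflect (forall x y, e (g x) (g y) = e x y) (is_aut e g).
Proof.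
apply: (iffP forallP) => [H x y | H x]; first by apply/eqP; have /forallP := H x.
by apply/forallP=> y; rewrite H.
Qed.

Lemma is_autM (g h : {perm T}) : is_aut e g -> is_aut e h -> is_aut e (g * h)%g.
Proof. by move=> /is_autP eg /is_autP eh; apply/is_autP=> x y; rewrite !permM eh eg. Qed.

Lemma is_autV (g : {perm T}) : is_aut e g -> is_aut e g^-1%g.
Proof.
by move=> /is_autP eg; apply/is_autP=> x y; rewrite -{2}(permKV g x) -{2}(permKV g y) eg.
Qed.

Lemma orientP u v :
  reflect (exists g : {perm T}, [/\ is_aut e g, g x0 = u & g y0 = v]) (D u v).
Proof.
apply: (iffP existsP) => -[g]; first by case/and3P=> ag /eqP gx /eqP gy; exists g.
by case=> ag gx gy; exists g; rewrite ag gx gy !eqxx.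
Qed.

Lemma orient_aut (g : {perm T}) u v : is_aut e g -> D (g u) (g v) = D u v.
Proof.
have H h x y : is_aut e h -> D x y -> D (h x) (h y).
  move=> ah /orientP[k [ak <- <-]]; apply/orientP; exists (k * h)%g.
  by rewrite !permM is_autM.
move=> ag; apply/idP/idP; last exact: H.
by move/(H _ _ _ (is_autV ag)); rewrite !permK.
Qed.

Lemma orient_trans u v u' v' : D u v -> D u' v' ->
  exists g : {perm T}, [/\ is_aut e g, g u = u' & g v = v'].
Proof.
move=> /orientP[g [ag <- <-]] /orientP[h [ah <- <-]]; exists (g^-1 * h)%g.
by rewrite !permM !permK is_autM ?is_autV.
Qed.

Lemma edge_orient u v : e u v = D u v || D v u.
Proof.
have [e_sym _] := e_simple; have [_ e_edge _] := e_hat.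
apply/idP/orP=> [euv | [] /orientP[g [/is_autP eg <- <-]]]; last 2 first.
- by rewrite eg.
- by rewrite e_sym eg.
have [g [ag [] [gx gy]]] := e_edge _ _ _ _ e00 euv; [left | right];
  by apply/orientP; exists g.
Qed.

(** If the chosen orbit contained one arc and its reverse, it would be closed under reversal, hence
    contain all arcs, giving arc-transitivity. *)
Lemma orient_asym u v : D u v -> ~~ D v u.
Proof.
move=> Duv; apply/negP=> Dvu; have [_ _] := e_hat; apply=> x y x' y'.
have D_sym z w : D z w -> D w z.
  move=> Dzw; have [g [ag <- <-]] := orient_trans Duv Dzw.
  by rewrite orient_aut.
have eD z w : e z w -> D z w by rewrite edge_orient => /orP[|/D_sym].
by move=> /eD Dxy /eD /(orient_trans Dxy)[g [ag gx gy]]; exists g.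
Qed.

(** Out-degree and in-degree are constant by vertex-transitivity, equal by double counting the arcs,
    and sum to 4. *)
Lemma orient_deg b v : #|[set u | role D b v u]| = 2.
Proof.
have [e_vert _ _] := e_hat; pose nbh c x := [set y | role D c x y].
have nbh_const c x y : #|nbh c x| = #|nbh c y|.
  have [g [ag <-]] := e_vert x y; rewrite -(card_imset _ (@perm_inj _ g)).
  apply: eq_card => z; rewrite -(permKV g z) (mem_imset _ _ (@perm_inj _ g)) !inE.
  by rewrite role_perm // => ? ?; apply: orient_aut.
have deg : #|nbh true v| + #|nbh false v| = 4.
  rewrite -(e_tetra v) -cardsUI (_ : nbh true v :&: nbh false v = set0) ?cards0 ?addn0.
    by apply: eq_card => z; rewrite !inE edge_orient.
  by apply/setP=> z; rewrite !inE; apply/negbTE/negP=> /andP[/orient_asym/negP].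
have sum_nbh : \sum_x #|nbh true x| = \sum_x #|nbh false x|.
  under eq_bigr do rewrite -sum1dep_card.
  under [RHS]eq_bigr do rewrite -sum1dep_card.
  by rewrite (exchange_big_dep predT).
have /eqP E : #|nbh true v| == #|nbh false v|.
  rewrite -(@eqn_pmul2l #|T|) -?sum_nat_const; last by apply/card_gt0P; exists v.
  rewrite (eq_bigr _ (fun x _ => nbh_const true v x)) sum_nbh.
  by rewrite (eq_bigr _ (fun x _ => nbh_const false x v)).
by move: deg; case: b; rewrite ?E -/(nbh _ v) -?E addnn -[4]/2.*2 => /double_inj.
Qed.

(** A reversal preserves adjacency, so it is an automorphism and would also preserve [D]. *)
Lemma no_orient_reversal (f : {perm T}) : ~ forall x y, D (f y) (f x) = D x y.
Proof.
move=> fD; have af : is_aut e f.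
  by apply/is_autP=> x y; rewrite !edge_orient !fD orbC.
have D00 : D x0 y0.
  by apply/orientP; exists 1%g; rewrite !perm1; split=> //; apply/is_autP=> x y; rewrite !perm1.
by have := orient_asym D00; rewrite -fD orient_aut ?D00 // => /negP[].
Qed.

End Orientation.

Theorem theorem1p2 (T : finType) (e : rel T) (x0 y0 : T) (r a : nat) :
  simple_graph e -> tetravalent e -> half_arc_transitive e -> e x0 y0 ->
  (* r = rad(Gamma): every alternating cycle has length 2r *)
  (forall s, alt_cycle (orient e x0 y0) e s -> size s = 2 * r) ->
  (* a = att(Gamma): two distinct alternating cycles sharing a vertex
     meet in exactly a vertices *)
  (forall s1 s2, alt_cycle (orient e x0 y0) e s1 ->
     alt_cycle (orient e x0 y0) e s2 ->
     cyc_edges s1 != cyc_edges s2 ->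
     cyc_verts s1 :&: cyc_verts s2 != set0 ->
     #|cyc_verts s1 :&: cyc_verts s2| = a) ->
  (odd r -> (a %| r)%N) /\ (~~ (4 %| a)%N -> (a %| r)%N).
Proof.
move=> e_simple e_tetra e_hat e00 rad att.
have asym := orient_asym e_simple e_hat e00.
have deg := orient_deg e_simple e_tetra e_hat e00.
have eD := edge_orient e_simple e_hat e00.
have trans u v u' v' : orient e x0 y0 u v -> orient e x0 y0 u' v' ->
    exists g : {perm T}, [/\ forall x y,
      orient e x0 y0 (g x) (g y) = orient e x0 y0 x y, g u = u' & g v = v'].
  move=> H /(orient_trans H)[g [ag gu gv]]; exists g; split=> // x y.
  exact: orient_aut.
have dvd2 := att_dvd asym deg trans eD rad att x0.
have dvd_odd : odd r -> a %| r.
  apply: (att_dvd_rad asym deg trans eD rad att x0) => f.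
  exact: no_orient_reversal.
(* For even [r], use [a %| 2 * r]. An odd [a] is coprime to 2; otherwise [a = 2m] with [m] odd, and
   [m] divides [r], hence [r / 2]. *)
split=> // n4a; case: (boolP (odd r)) => [// | /negPf er].
have Er : r = r./2.*2 by rewrite -{1}(odd_double_half r) er.
case: (boolP (odd a)) => [oa | /negPf ea].
  by rewrite -(@Gauss_dvdr a 2) ?coprimen2.
have Ea : a = a./2.*2 by rewrite -{1}(odd_double_half a) ea.
move: dvd2 n4a; rewrite Ea -muln2 [a./2 * 2]mulnC -[4]/(2 * 2) !dvdn_pmul2l // dvdn2 negbK.
move=> dvd_ar oh; rewrite Er -mul2n dvdn_pmul2l //.
by rewrite -(@Gauss_dvdr _ 2) ?coprimen2 // mul2n -Er.
Qed.
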